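(* Any object $(S_l,S_r,\Psi,\sqcap:\mathcal M\to\mathcal C,i,\sqcup:\mathcal D\to\mathcal M,w)$ of the category $\mathcal B$ determines a functor from $\mathcal D$ to the category of para-cyclic objects in $\mathcal C$, sending an object $Y$ of $\mathcal D$ to the para-cyclic object with degree $n$ part $\sqcap S_l^{n+1}\sqcup Y$ ($n\ge0$), and structure morphisms, for $0\le k\le n$, the components at $Y$ of $$d_k=\sqcap S_l^k e_l S_l^{n-k}\sqcup\ (n\ge1),\qquad s_k=\sqcap S_l^k d_l S_l^{n-k}\sqcup,\qquad t_n=iS_l^n\sqcup\circ\sqcap\Psi^n\sqcup\circ\sqcap S_l^nw,$$ and sending a morphism $f$ of $\mathcal D$ to the family $(\sqcap S_l^{n+1}\sqcup f)_{n\ge0}$.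
   Context: Composition of functors is written by juxtaposition, $GvH$ denotes whiskering of a natural transformation $v$, and $\circ$ is vertical composition. $(S_l,d_l,e_l)$ and $(S_r,d_r,e_r)$ denote comonads with their comultiplications $d$ and counits $e$. A comonad distributive law between comonads $S_l,S_r$ on $\mathcal M$ is a natural transformation $\Psi:S_lS_r\to S_rS_l$ with $S_rd_l\circ\Psi=\Psi S_l\circ S_l\Psi\circ d_lS_r$, $S_re_l\circ\Psi=e_lS_r$, $d_rS_l\circ\Psi=S_r\Psi\circ\Psi S_r\circ S_ld_r$, $e_rS_l\circ\Psi=S_le_r$. An object of $\mathcal B$ is a septuple $(S_l,S_r,\Psi,\sqcap,i,\sqcup,w)$ where $S_l,S_r$ are comonads on the same category $\mathcal M$; $\Psi:S_lS_r\to S_rS_l$ is a comonad distributive law; $(\sqcap:\mathcal M\to\mathcal C,\ i:\sqcap S_r\to\sqcap S_l)$ is a right $\Psi$-comodule functor, i.e. $i$ is a natural transformation with $\sqcap d_l\circ i=iS_l\circ\sqcap\Psi\circ iS_r\circ\sqcap d_r$ and $\sqcap e_l\circ i=\sqcap e_r$; and $(\sqcup:\mathcal D\to\mathcal M,\ w:S_l\sqcup\to S_r\sqcup)$ is a left $\Psi$-comodule functor, i.e. $w$ is a natural transformation with $d_r\sqcup\circ w=S_rw\circ\Psi\sqcup\circ S_lw\circ d_l\sqcup$ and $e_r\sqcup\circ w=e_l\sqcup$. $\Psi^n:S_l^nS_r\to S_rS_l^n$ is defined by $\Psi^0=$ identity of $S_r$, $\Psi^1=\Psi$, $\Psi^n=\Psi^{n-1}S_l\circ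 S_l^{n-1}\Psi$. A para-cyclic object in a category is a simplicial object $(Z_n)_{n\ge0}$ with faces $d_k:Z_n\to Z_{n-1}$ and degeneracies $s_k:Z_n\to Z_{n+1}$ ($0\le k\le n$), together with morphisms $t_n:Z_n\to Z_n$ such that for $1\le k\le n$: $d_0\circ t_n=d_n$, $d_k\circ t_n=t_{n-1}\circ d_{k-1}$, $s_0\circ t_n=t_{n+1}\circ t_{n+1}\circ s_n$, $s_k\circ t_n=t_{n+1}\circ s_{k-1}$ (the relation for $d_0$ when $n\ge1$, that for $s_0$ when $n\ge0$). Morphisms are families $f_n:Z_n\to Z'_n$ compatible with faces, degeneracies and $t$'s. *)

(* Defs.v *)
From mathcomp Require Import all_boot.
From Stdlib Require Import FunctionalExtensionality ProofIrrelevance.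

Set Implicit Arguments.
Unset Strict Implicit.
Unset Printing Implicit Defensive.

Declare Scope cat_scope.
Delimit Scope cat_scope with cat.
Local Open Scope cat_scope.

Record category := Category {
  ob :> Type;
  hom : ob -> ob -> Type;
  idm : forall X, hom X X;
  comp : forall X Y Z, hom Y Z -> hom X Y -> hom X Z;
  comp_idl : forall X Y (f : hom X Y), comp (idm Y) f = f;
  comp_idr : forall X Y (f : hom X Y), comp f (idm X) = f;
  comp_assoc : forall X Y Z T (h : hom Z T) (g : hom Y Z) (f : hom X Y),
    comp h (comp g f) = comp (comp h g) f }.

Arguments idm {c} X : rename.
Notation "g ∘ f" := (comp g f) (at level 40, left associativity) : cat_scope.

Record is_functor (C D : category) (F0 : C -> D)
    (F1 : forall X Y, hom X Y -> hom (F0 X) (F0 Y)) : Prop := IsFunctor {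
  functor_id : forall X, F1 X X (idm X) = idm (F0 X);
  functor_comp : forall X Y Z (g : hom Y Z) (f : hom X Y),
    F1 X Z (g ∘ f) = F1 Y Z g ∘ F1 X Y f }.

Record functor (C D : category) := Functor {
  fobj :> C -> D;
  fmap : forall X Y, hom X Y -> hom (fobj X) (fobj Y);
  fmapP : is_functor fmap }.

Lemma id_functorP (C : category) :
  is_functor (fun (X Y : C) (f : hom X Y) => f).
Proof. by split. Qed.

Definition id_functor (C : category) : functor C C :=
  Functor (id_functorP C).

Lemma comp_functorP (C D E : category) (G : functor D E) (F : functor C D) :
  is_functor (fun (X Y : C) (f : hom X Y) => fmap G (fmap F f)).
Proof.
case: (fmapP F) (fmapP G) => Fid Fcomp [Gid Gcomp].
by split=> *; rewrite ?Fid ?Fcomp ?Gid ?Gcomp.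
Qed.

Definition comp_functor (C D E : category) (G : functor D E) (F : functor C D)
  : functor C E := Functor (comp_functorP G F).

Notation "G ⊚ F" := (comp_functor G F)
  (at level 40, left associativity) : cat_scope.

Record nat_trans (C D : category) (F G : functor C D) := NatTrans {
  ntapp :> forall X, hom (F X) (G X);
  nt_natural : forall X Y (f : hom X Y),
    fmap G f ∘ ntapp X = ntapp Y ∘ fmap F f }.

(* Below, equations between whiskered natural transformations are written
   componentwise: (G v H)_X = fmap G (v (H X)). *)

Record comonad (M : category) := Comonad {
  cm_functor :> functor M M;
  cm_d : nat_trans cm_functor (cm_functor ⊚ cm_functor);
  cm_e : nat_trans cm_functor (id_functor M);
  cm_coassoc : forall X,
    fmap cm_functor (cm_d X) ∘ cm_d X = cm_d (cm_functor X) ∘ cm_d X;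
  cm_counitl : forall X, cm_e (cm_functor X) ∘ cm_d X = idm (cm_functor X);
  cm_counitr : forall X,
    fmap cm_functor (cm_e X) ∘ cm_d X = idm (cm_functor X) }.

Record distributive_law (M : category) (Sl Sr : comonad M) := DistributiveLaw {
  dl_nt :> nat_trans (Sl ⊚ Sr) (Sr ⊚ Sl);
  dl_dl : forall X,
    fmap Sr (cm_d Sl X) ∘ dl_nt X =
    dl_nt (Sl X) ∘ fmap Sl (dl_nt X) ∘ cm_d Sl (Sr X);
  dl_el : forall X, fmap Sr (cm_e Sl X) ∘ dl_nt X = cm_e Sl (Sr X);
  dl_dr : forall X,
    cm_d Sr (Sl X) ∘ dl_nt X =
    fmap Sr (dl_nt X) ∘ dl_nt (Sr X) ∘ fmap Sl (cm_d Sr X);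
  dl_er : forall X, cm_e Sr (Sl X) ∘ dl_nt X = fmap Sl (cm_e Sr X) }.

Record right_comodule_functor (M C : category) (Sl Sr : comonad M)
    (Psi : distributive_law Sl Sr) := RightComoduleFunctor {
  rc_functor :> functor M C;
  rc_i : nat_trans (rc_functor ⊚ Sr) (rc_functor ⊚ Sl);
  rc_d : forall X,
    fmap rc_functor (cm_d Sl X) ∘ rc_i X =
    rc_i (Sl X) ∘ fmap rc_functor (Psi X) ∘ rc_i (Sr X)
      ∘ fmap rc_functor (cm_d Sr X);
  rc_e : forall X,
    fmap rc_functor (cm_e Sl X) ∘ rc_i X = fmap rc_functor (cm_e Sr X) }.

Record left_comodule_functor (M D : category) (Sl Sr : comonad M)
    (Psi : distributive_law Sl Sr) := LeftComoduleFunctor {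
  lc_functor :> functor D M;
  lc_w : nat_trans (Sl ⊚ lc_functor) (Sr ⊚ lc_functor);
  lc_d : forall Y,
    cm_d Sr (lc_functor Y) ∘ lc_w Y =
    fmap Sr (lc_w Y) ∘ Psi (lc_functor Y) ∘ fmap Sl (lc_w Y)
      ∘ cm_d Sl (lc_functor Y);
  lc_e : forall Y, cm_e Sr (lc_functor Y) ∘ lc_w Y = cm_e Sl (lc_functor Y) }.

Record b_object (M C D : category) := BObject {
  bSl : comonad M;
  bSr : comonad M;
  bPsi : distributive_law bSl bSr;
  bcap : right_comodule_functor C bPsi;
  bcup : left_comodule_functor D bPsi }.

(* The recursion F^(n+1) = F^n F makes whiskering on the right by F an
   application at F X: if v_X : F^a X -> F^b X then (v F)_X = v_(F X) has type
   F^(a+1) X -> F^(b+1) X by conversion, and no cast between iterated powers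
   is needed below. *)
Fixpoint fpow (M : category) (F : functor M M) (n : nat) : functor M M :=
  if n is n'.+1 then fpow F n' ⊚ F else id_functor M.

(* For k <= n, the component at X of F^k e F^(n-k), where e : F -> Id.
   For k < n it is (F^k e F^(n-1-k)) F. *)
Fixpoint pow_counit (M : category) (S : comonad M) (n k : nat) (X : M)
    : hom (fpow S n.+1 X) (fpow S n X) :=
  match n return hom (fpow S n.+1 X) (fpow S n X) with
  | 0 => cm_e S X
  | n'.+1 => if k <= n' then pow_counit S n' k (S X)
             else fmap (fpow S n'.+1) (cm_e S X)
  end.

(* For k <= n, the component at X of S^k d S^(n-k). *)
Fixpoint pow_comult (M : category) (S : comonad M) (n k : nat) (X : M)
    : hom (fpow S n.+1 X) (fpow S n.+2 X) :=
  match n return hom (fpow S n.+1 X) (fpow S n.+2 X) with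
  | 0 => cm_d S X
  | n'.+1 => if k <= n' then pow_comult S n' k (S X)
             else fmap (fpow S n'.+1) (cm_d S X)
  end.

(* Psi^0 = id and Psi^(n+1) = Psi^n S_l o S_l^n Psi. *)
Fixpoint pow_psi (M : category) (Sl Sr : comonad M)
    (Psi : distributive_law Sl Sr) (n : nat) (X : M)
    : hom (fpow Sl n (Sr X)) (Sr (fpow Sl n X)) :=
  match n return hom (fpow Sl n (Sr X)) (Sr (fpow Sl n X)) with
  | 0 => idm (Sr X)
  | n'.+1 => pow_psi Psi n' (Sl X) ∘ fmap (fpow Sl n') (Psi X)
  end.

(* The component at X of i S_l^n, through i S_l^(n+1) = (i S_l^n) S_l. *)
Fixpoint pow_i (M C : category) (Sl Sr : comonad M)
    (Psi : distributive_law Sl Sr) (cap : right_comodule_functor C Psi)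
    (n : nat) (X : M) : hom (cap (Sr (fpow Sl n X))) (cap (fpow Sl n.+1 X)) :=
  match n return hom (cap (Sr (fpow Sl n X))) (cap (fpow Sl n.+1 X)) with
  | 0 => rc_i cap X
  | n'.+1 => pow_i cap n' (Sl X)
  end.

(* The faces pc_face n k : Z_(n+1) -> Z_n are indexed by their target. *)
Record pc_data (C : category) := PCData {
  pc_ob :> nat -> C;
  pc_face : forall n, 'I_n.+2 -> hom (pc_ob n.+1) (pc_ob n);
  pc_degen : forall n, 'I_n.+1 -> hom (pc_ob n) (pc_ob n.+1);
  pc_t : forall n, hom (pc_ob n) (pc_ob n) }.

Definition d_ (C : category) (Z : pc_data C) (n k : nat)
    : hom (Z n.+1) (Z n) := pc_face Z (inord k).
Definition s_ (C : category) (Z : pc_data C) (n k : nat)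
    : hom (Z n) (Z n.+1) := pc_degen Z (inord k).

(* inord is only meaningful in range; every relation below bounds its indices
   accordingly. *)
Record is_simplicial (C : category) (Z : pc_data C) : Prop := IsSimplicial {
  face_face : forall n i j, i < j -> j <= n.+2 ->
    d_ Z n i ∘ d_ Z n.+1 j = d_ Z n j.-1 ∘ d_ Z n.+1 i;
  degen_degen : forall n i j, i <= j -> j <= n ->
    s_ Z n.+1 i ∘ s_ Z n j = s_ Z n.+1 j.+1 ∘ s_ Z n i;
  face_degen_lt : forall n i j, i < j -> j <= n.+1 ->
    d_ Z n.+1 i ∘ s_ Z n.+1 j = s_ Z n j.-1 ∘ d_ Z n i;
  face_degen_id : forall n j, j <= n -> d_ Z n j ∘ s_ Z n j = idm (Z n);
  face_degen_idS : forall n j, j <= n -> d_ Z n j.+1 ∘ s_ Z n j = idm (Z n);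
  face_degen_gt : forall n i j, j.+1 < i -> i <= n.+2 ->
    d_ Z n.+1 i ∘ s_ Z n.+1 j = s_ Z n j ∘ d_ Z n i.-1 }.

Record is_para_cyclic (C : category) (Z : pc_data C) : Prop := IsParaCyclic {
  pc_simplicial : is_simplicial Z;
  face0_t : forall n, d_ Z n 0 ∘ pc_t Z n.+1 = d_ Z n n.+1;
  face_t : forall n k, 1 <= k <= n.+1 ->
    d_ Z n k ∘ pc_t Z n.+1 = pc_t Z n ∘ d_ Z n k.-1;
  degen0_t : forall n,
    s_ Z n 0 ∘ pc_t Z n = pc_t Z n.+1 ∘ pc_t Z n.+1 ∘ s_ Z n n;
  degen_t : forall n k, 1 <= k <= n ->
    s_ Z n k ∘ pc_t Z n = pc_t Z n.+1 ∘ s_ Z n k.-1 }.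

Record para_cyclic_object (C : category) := ParaCyclicObject {
  pco_data :> pc_data C;
  pcoP : is_para_cyclic pco_data }.

Record is_pc_morphism (C : category) (Z Z' : pc_data C)
    (f : forall n, hom (Z n) (Z' n)) : Prop := IsPCMorphism {
  pcm_face : forall n (k : 'I_n.+2),
    f n ∘ pc_face Z k = pc_face Z' k ∘ f n.+1;
  pcm_degen : forall n (k : 'I_n.+1),
    f n.+1 ∘ pc_degen Z k = pc_degen Z' k ∘ f n;
  pcm_t : forall n, f n ∘ pc_t Z n = pc_t Z' n ∘ f n }.

Record pc_morphism (C : category) (Z Z' : para_cyclic_object C) := PCMorphism {
  pcm_app :> forall n, hom (Z n) (Z' n);
  pcmP : is_pc_morphism pcm_app }.

Lemma pc_morphism_eq (C : category) (Z Z' : para_cyclic_object C)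
    (f g : pc_morphism Z Z') : (forall n, f n = g n) -> f = g.
Proof.
case: f g => [f hf] [g hg] /= fg.
have {}fg : f = g by apply: functional_extensionality_dep.
by case: g / fg hg => hg; rewrite (proof_irrelevance _ hf hg).
Qed.

Lemma pc_idP (C : category) (Z : para_cyclic_object C) :
  is_pc_morphism (fun n => idm (Z n)).
Proof. by split=> *; rewrite comp_idl comp_idr. Qed.

Lemma pc_compP (C : category) (Z Z' Z'' : para_cyclic_object C)
    (g : pc_morphism Z' Z'') (f : pc_morphism Z Z') :
  is_pc_morphism (fun n => g n ∘ f n).
Proof.
case: f g => [f [fd fs ft]] [g [gd gs gt]].
by split=> * /=;
  rewrite -comp_assoc ?fd ?fs ?ft comp_assoc ?gd ?gs ?gt -comp_assoc.
Qed.

Definition para_cyclic (C : category) : category.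
Proof.
refine (@Category (para_cyclic_object C) (@pc_morphism C)
  (fun Z => PCMorphism (pc_idP Z))
  (fun Z Z' Z'' g f => PCMorphism (pc_compP g f)) _ _ _).
- by move=> *; apply: pc_morphism_eq => n /=; rewrite comp_idl.
- by move=> *; apply: pc_morphism_eq => n /=; rewrite comp_idr.
- by move=> *; apply: pc_morphism_eq => n /=; rewrite comp_assoc.
Defined.

(* The simplicial d_k on Z_(n+1) is cap S_l^k e_l S_l^(n+1-k) cup. *)
Definition b_data (M C D : category) (B : b_object M C D) (Y : D)
    : pc_data C := {|
  pc_ob := fun n => bcap B (fpow (bSl B) n.+1 (bcup B Y));
  pc_face := fun n k =>
    fmap (bcap B) (pow_counit (bSl B) n.+1 k (bcup B Y));
  pc_degen := fun n k => fmap (bcap B) (pow_comult (bSl B) n k (bcup B Y));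
  pc_t := fun n =>
    pow_i (bcap B) n (bcup B Y)
      ∘ fmap (bcap B) (pow_psi (bPsi B) n (bcup B Y))
      ∘ fmap (bcap B) (fmap (fpow (bSl B) n) (lc_w (bcup B) Y)) |}.

Definition b_mor (M C D : category) (B : b_object M C D) (Y Y' : D)
    (f : hom Y Y') (n : nat) : hom (b_data B Y n) (b_data B Y' n) :=
  fmap (bcap B) (fmap (fpow (bSl B) n.+1) (fmap (bcup B) f)).

(* Main.v *)
Require Import Defs.
From mathcomp Require Import all_boot.

(** Every structure map of the para-cyclic object is a whiskering, so every
    relation follows from naturality and the axioms of the data.

    The faces and degeneracies are the image under the functor cap of the
    canonical simplicial operators on the iterates of the comonad [Sl]; they
    satisfy the simplicial identities because [Sl] is coassociative and
    counital, and because transformations inserted at disjoint places of an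
    iterate commute.

    For the cyclic operator, the idea is to separate the part that involves
    [w]: let the turn be the transformation
    [i Sl^n o cap Psi^n : cap Sl^n Sr -> cap Sl^n.+1], which carries the
    letter [Sr] leftwards across the [n] letters [Sl] and, at the left end,
    turns it into an [Sl].  Then [t_n] is the turn preceded by [w], which
    creates the letter [Sr] from the rightmost [Sl].  The turn obeys the
    recursion [turn_n.+1 = turn_n Sl o cap Sl^n Psi], so its relations with
    faces and degeneracies, unlike those of [t_n] itself, can be proved by
    induction on [n].  There are two kinds of them.  An operation at the left
    end of the word meets [i]: it is converted into the counit or the
    comultiplication of [Sr] by the comodule axioms of [i], and moved back to
    the right end by the axioms of [Psi] that concern [Sr] ([counit0_turn],
    [comult0_turn]).  Any other operation meets one of the factors [Psi]: it
    passes the letter [Sr] by an axiom of [Psi] that concerns [Sl], and so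
    acts one position further to the left before the turn than after it
    ([counit_turn], [comult_turn]).  The comodule axioms of [w] enter only
    after the induction, at the right end, where they convert the counit and
    the comultiplication of [Sr] into those of [Sl]. *)

Set Implicit Arguments.
Unset Strict Implicit.
Unset Printing Implicit Defensive.
Local Open Scope cat_scope.

(** * Functor calculus *)

Lemma fmap_id (C D : category) (F : functor C D) (X : C) :
  fmap F (idm X) = idm (F X).
Proof. exact: functor_id (fmapP F) X. Qed.

Lemma fmap_comp (C D : category) (F : functor C D) (X Y Z : C)
    (g : hom Y Z) (f : hom X Y) : fmap F (g ∘ f) = fmap F g ∘ fmap F f.
Proof. exact: functor_comp (fmapP F) _ _ _ g f. Qed.

Lemma fmap_triangle (C D : category) (F : functor C D) (X Y Z : C)
    (g : hom Y Z) (f : hom X Y) (h : hom X Z) :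
  g ∘ f = h -> fmap F g ∘ fmap F f = fmap F h.
Proof. by move=> <-; rewrite fmap_comp. Qed.

Lemma fmap_square (C D : category) (F : functor C D) (X Y Y' Z : C)
    (g : hom Y Z) (f : hom X Y) (g' : hom Y' Z) (f' : hom X Y') :
  g ∘ f = g' ∘ f' -> fmap F g ∘ fmap F f = fmap F g' ∘ fmap F f'.
Proof. by move=> E; rewrite -!fmap_comp E. Qed.

(** * Counits and comultiplications inside iterates of a comonad *)

Section Iterates.

Variables (M : category) (S : comonad M).

Lemma pow_counitS n k (X : M) : k <= n ->
  pow_counit S n.+1 k X = pow_counit S n k (S X).
Proof. by move=> /= ->. Qed.

Lemma pow_counit_last n (X : M) :
  pow_counit S n n X = fmap (fpow S n) (cm_e S X).
Proof. by case: n => //= n; rewrite ltnn. Qed.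

Lemma pow_comultS n k (X : M) : k <= n ->
  pow_comult S n.+1 k X = pow_comult S n k (S X).
Proof. by move=> /= ->. Qed.

Lemma pow_comult_last n (X : M) :
  pow_comult S n n X = fmap (fpow S n) (cm_d S X).
Proof. by case: n => //= n; rewrite ltnn. Qed.

Lemma pow_counit_natural n k (X Y : M) (f : hom X Y) :
  fmap (fpow S n) f ∘ pow_counit S n k X =
  pow_counit S n k Y ∘ fmap (fpow S n.+1) f.
Proof.
elim: n X Y f => [|n IHn] X Y f; first exact: nt_natural (cm_e S) _ _ f.
rewrite /pow_counit -/pow_counit; case: (k <= n); first exact: IHn.
exact: (fmap_square (fpow S n.+1) (nt_natural (cm_e S) f)).
Qed.

Lemma pow_comult_natural n k (X Y : M) (f : hom X Y) :
  fmap (fpow S n.+2) f ∘ pow_comult S n k X =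
  pow_comult S n k Y ∘ fmap (fpow S n.+1) f.
Proof.
elim: n X Y f => [|n IHn] X Y f; first exact: nt_natural (cm_d S) _ _ f.
rewrite /pow_comult -/pow_comult; case: (k <= n); first exact: IHn.
exact: (fmap_square (fpow S n.+1) (nt_natural (cm_d S) f)).
Qed.

(** The simplicial identities that follow share one argument: the induction
    strips the innermost copies of [S] until the larger index is the last one;
    then either the two operators act at disjoint places and naturality
    applies, or they meet and a comonad axiom does. *)
Lemma counit_counit n i j (X : M) : i < j -> j <= n.+1 ->
  pow_counit S n i X ∘ pow_counit S n.+1 j X =
  pow_counit S n j.-1 X ∘ pow_counit S n.+1 i X.
Proof.
case: j => // j le_ij.
have last m Y : i <= m -> pow_counit S m i Y ∘ pow_counit S m.+1 m.+1 Y =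
    pow_counit S m m Y ∘ pow_counit S m.+1 i Y.
  move=> le_im; rewrite (pow_counitS Y le_im) !pow_counit_last.
  exact: esym (pow_counit_natural m i (cm_e S Y)).
elim: n X => [|n IHn] X; rewrite ltnS leq_eqVlt => /predU1P[Ej|lt_jn] //;
  try by subst j; exact: last.
have le_in : i <= n by exact: leq_trans le_ij lt_jn.
rewrite (@pow_counitS n.+1 j.+1 X lt_jn) (@pow_counitS n i X le_in).
rewrite (@pow_counitS n j X lt_jn) (@pow_counitS n.+1 i X (leqW le_in)).
exact: IHn.
Qed.

Lemma comult_comult n i j (X : M) : i <= j -> j <= n ->
  pow_comult S n.+1 i X ∘ pow_comult S n j X =
  pow_comult S n.+1 j.+1 X ∘ pow_comult S n i X.
Proof.
elim: n X => [|n IHn] X le_ij; rewrite leq_eqVlt => /predU1P[Ej|lt_jn] //.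
- by subst j; move: le_ij; rewrite leqn0 => /eqP->; apply/esym/cm_coassoc.
- subst j; rewrite (@pow_comultS n.+1 i X le_ij).
  rewrite [pow_comult S _ n.+1 X]pow_comult_last.
  rewrite [pow_comult S _ n.+2 X]pow_comult_last.
  move: le_ij; rewrite leq_eqVlt => /predU1P[->|lt_in].
    rewrite !pow_comult_last.
    exact/esym/(fmap_square (fpow S n.+1) (cm_coassoc S X)).
  rewrite (@pow_comultS n i X lt_in) (@pow_comultS n i (S X) lt_in).
  exact: esym (pow_comult_natural _ i (cm_d S X)).
- have le_in : i <= n by exact: leq_trans le_ij lt_jn.
  rewrite (@pow_comultS n.+1 i X (leqW le_in)) (@pow_comultS n j X lt_jn).
  rewrite (@pow_comultS n i X le_in) (@pow_comultS n.+1 j.+1 X lt_jn).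
  exact: IHn.
Qed.

Lemma counit_comult_lt n i j (X : M) : i < j -> j <= n.+1 ->
  pow_counit S n.+2 i X ∘ pow_comult S n.+1 j X =
  pow_comult S n j.-1 X ∘ pow_counit S n.+1 i X.
Proof.
case: j => // j le_ij.
have last m Y : i <= m -> pow_counit S m.+2 i Y ∘ pow_comult S m.+1 m.+1 Y =
    pow_comult S m m Y ∘ pow_counit S m.+1 i Y.
  move=> le_im; rewrite (@pow_counitS m.+1 i Y (leqW le_im)).
  rewrite (pow_counitS Y le_im) (pow_counitS (S Y) le_im) !pow_comult_last.
  exact: esym (pow_counit_natural m i (cm_d S Y)).
elim: n X => [|n IHn] X; rewrite ltnS leq_eqVlt => /predU1P[Ej|lt_jn] //;
  try by subst j; exact: last.
have le_in : i <= n by exact: leq_trans le_ij lt_jn.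
rewrite (@pow_counitS n.+2 i X (leqW (leqW le_in))).
rewrite (@pow_comultS n.+1 j.+1 X lt_jn) (@pow_comultS n j X lt_jn).
rewrite (@pow_counitS n.+1 i X (leqW le_in)).
exact: IHn.
Qed.

Lemma counit_comult_id n j (X : M) : j <= n ->
  pow_counit S n.+1 j X ∘ pow_comult S n j X = idm (fpow S n.+1 X).
Proof.
elim: n X => [|n IHn] X; rewrite leq_eqVlt => /predU1P[Ej|lt_jn] //.
- by subst j; apply: cm_counitl.
- subst j; rewrite pow_counitS // pow_counit_last pow_comult_last.
  rewrite (fmap_triangle (fpow S n.+1) (cm_counitl S X)).
  exact: (fmap_id (fpow S n.+1)).
- rewrite (@pow_counitS n.+1 j X (leqW lt_jn)) (@pow_comultS n j X lt_jn).
  exact: IHn.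
Qed.

Lemma counit_comult_idS n j (X : M) : j <= n ->
  pow_counit S n.+1 j.+1 X ∘ pow_comult S n j X = idm (fpow S n.+1 X).
Proof.
elim: n X => [|n IHn] X; rewrite leq_eqVlt => /predU1P[Ej|lt_jn] //.
- by subst j; apply: cm_counitr.
- subst j; rewrite pow_counit_last pow_comult_last.
  rewrite (fmap_triangle (fpow S n.+1) (cm_counitr S X)).
  exact: (fmap_id (fpow S n.+1)).
- rewrite (@pow_counitS n.+1 j.+1 X lt_jn) (@pow_comultS n j X lt_jn).
  exact: IHn.
Qed.

Lemma counit_comult_gt n i j (X : M) : j.+1 < i -> i <= n.+2 ->
  pow_counit S n.+2 i X ∘ pow_comult S n.+1 j X =
  pow_comult S n j X ∘ pow_counit S n.+1 i.-1 X.
Proof.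
case: i => [|[|i]] //; rewrite !ltnS => le_ji.
have last m Y : j <= m -> pow_counit S m.+2 m.+2 Y ∘ pow_comult S m.+1 j Y =
    pow_comult S m j Y ∘ pow_counit S m.+1 m.+1 Y.
  move=> le_jm; rewrite (pow_comultS Y le_jm) !pow_counit_last.
  exact: (pow_comult_natural m j (cm_e S Y)).
elim: n X => [|n IHn] X; rewrite leq_eqVlt => /predU1P[Ei|lt_in] //;
  try by subst i; exact: last.
have le_jn : j <= n by exact: leq_trans le_ji lt_in.
rewrite (@pow_counitS n.+2 i.+2 X lt_in) (@pow_comultS n.+1 j X (leqW le_jn)).
rewrite (@pow_comultS n j X le_jn) (@pow_counitS n.+1 i.+1 X lt_in).
exact: IHn.
Qed.

End Iterates.

(** * Carrying a letter across the iterates *)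

Section Turn.

Variables (M C : category) (Sl Sr : comonad M) (Psi : distributive_law Sl Sr).
Variable cap : right_comodule_functor C Psi.

(* Just as for [fpow], [capS n.+1 X] and [capS n (Sl X)] are convertible. *)
Let capS n : functor M C := cap ⊚ fpow Sl n.

(** Locked so that a turn remains a single factor of a composite:
    reassociating must not split it into its two halves. *)
Definition turn n (X : M) : hom (capS n (Sr X)) (capS n.+1 X) :=
  locked (pow_i cap n X ∘ fmap cap (pow_psi Psi n X)).

Lemma turn0 (X : M) : turn 0 X = rc_i cap X.
Proof. by rewrite /turn -!lock /= fmap_id comp_idr. Qed.

Lemma turnS n (X : M) : turn n.+1 X = turn n (Sl X) ∘ fmap (capS n) (Psi X).
Proof. by rewrite /turn -!lock /= fmap_comp comp_assoc. Qed.

Lemma turn_natural n (X Y : M) (f : hom X Y) :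
  fmap (capS n.+1) f ∘ turn n X = turn n Y ∘ fmap (capS n) (fmap Sr f).
Proof.
elim: n X Y f => [|n IHn] X Y f.
  by rewrite !turn0; exact: nt_natural (rc_i cap) _ _ f.
rewrite !turnS comp_assoc.
rewrite (IHn _ _ (fmap Sl f)) -!comp_assoc; congr (_ ∘ _).
exact: (fmap_square (capS n) (nt_natural Psi f)).
Qed.

(** Erasing the letter that arrives at the left end amounts to erasing [Sr]
    before its journey: [rc_e] at the end of the journey, [dl_er] for each
    letter crossed. *)
Lemma counit0_turn n (X : M) :
  fmap cap (pow_counit Sl n 0 X) ∘ turn n X = fmap (capS n) (cm_e Sr X).
Proof.
elim: n X => [|n IHn] X; first by rewrite turn0; exact: rc_e.
rewrite turnS pow_counitS // comp_assoc IHn.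
exact: (fmap_triangle (capS n) (dl_er Psi X)).
Qed.

(** The shift of the index comes from the innermost [Psi]: by [dl_el], erasing
    the last [Sl] after [Sr] has crossed it amounts to erasing it before, and
    then the leftmost letter [Sl] that [Sr] becomes is not yet there to be
    counted. *)
Lemma counit_turn n k (X : M) : k <= n ->
  fmap cap (pow_counit Sl n.+1 k.+1 X) ∘ turn n.+1 X =
  turn n X ∘ fmap cap (pow_counit Sl n k (Sr X)).
Proof.
have last m Y : fmap cap (pow_counit Sl m.+1 m.+1 Y) ∘ turn m.+1 Y =
                turn m Y ∘ fmap cap (pow_counit Sl m m (Sr Y)).
  rewrite !pow_counit_last turnS comp_assoc.
  rewrite (turn_natural m (cm_e Sl Y)) -comp_assoc; congr (_ ∘ _).
  exact: (fmap_triangle (capS m) (dl_el Psi Y)).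
elim: n X => [|n IHn] X; rewrite leq_eqVlt => /predU1P[->|lt_kn] //.
rewrite (@pow_counitS _ Sl n.+1 k.+1 X lt_kn).
rewrite (@pow_counitS _ Sl n k (Sr X) lt_kn).
rewrite (turnS n.+1) comp_assoc (IHn _ lt_kn) (turnS n) -!comp_assoc.
congr (_ ∘ _).
exact: esym (fmap_square cap (pow_counit_natural Sl n k (Psi X))).
Qed.

(** The comultiplied [Sl] counts as two letters for [Sr] to cross: by [dl_dl]
    a single [Psi] before the comultiplication becomes two after it, which
    lengthens the turn by one step. *)
Lemma comult_turn n k (X : M) : k <= n ->
  fmap cap (pow_comult Sl n.+1 k.+1 X) ∘ turn n.+1 X =
  turn n.+2 X ∘ fmap cap (pow_comult Sl n k (Sr X)).
Proof.
have last m Y : fmap cap (pow_comult Sl m.+1 m.+1 Y) ∘ turn m.+1 Y =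
                turn m.+2 Y ∘ fmap cap (pow_comult Sl m m (Sr Y)).
  rewrite !pow_comult_last (turnS m.+1) !(turnS m) comp_assoc.
  rewrite (turn_natural m (cm_d Sl Y)) -!comp_assoc; congr (_ ∘ _).
  have := congr1 (fun f => fmap (capS m) f) (dl_dl Psi Y).
  by rewrite !fmap_comp -comp_assoc.
elim: n X => [|n IHn] X; rewrite leq_eqVlt => /predU1P[->|lt_kn] //.
rewrite (@pow_comultS _ Sl n.+1 k.+1 X lt_kn).
rewrite (@pow_comultS _ Sl n k (Sr X) lt_kn).
rewrite (turnS n.+1) comp_assoc (IHn _ lt_kn) (turnS n.+2) -!comp_assoc.
congr (_ ∘ _).
exact: esym (fmap_square cap (pow_comult_natural Sl n k (Psi X))).
Qed.

(** Doubling the letter that arrives at the left end amounts to doubling [Sr]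
    before its journey and letting the two copies travel one after the other:
    [rc_d] at the end of the journey, [dl_dr] for each letter crossed.  The
    copy that starts second has one more [Sl] to cross, the one that the first
    copy has become. *)
Lemma comult0_turn n (X : M) :
  fmap cap (pow_comult Sl n 0 X) ∘ turn n X =
  turn n.+1 X ∘ turn n (Sr X) ∘ fmap (capS n) (cm_d Sr X).
Proof.
elim: n X => [|n IHn] X.
  rewrite turnS !turn0; exact: rc_d.
rewrite (turnS n X) pow_comultS // comp_assoc IHn.
rewrite (turnS n.+1 X) (turnS n (Sr X)) -!comp_assoc; congr (_ ∘ _).
rewrite [in RHS]comp_assoc (turn_natural n (Psi X)) -!comp_assoc.
congr (_ ∘ _).
have := congr1 (fun f => fmap (capS n) f) (dl_dr Psi X).
by rewrite !fmap_comp -comp_assoc.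
Qed.

End Turn.

(** * The para-cyclic object *)

Section ParaCyclic.

Variables (M C D : category) (B : b_object M C D).

Let Sl := bSl B.
Let cap := bcap B.
Let cup := bcup B.
Let capS n : functor M C := cap ⊚ fpow Sl n.

Lemma b_faceE (Y : D) n k : k <= n.+1 ->
  d_ (b_data B Y) n k = fmap cap (pow_counit Sl n.+1 k (cup Y)).
Proof. by move=> le_kn; rewrite /d_ /= inordK. Qed.

Lemma b_degenE (Y : D) n k : k <= n ->
  s_ (b_data B Y) n k = fmap cap (pow_comult Sl n k (cup Y)).
Proof. by move=> le_kn; rewrite /s_ /= inordK. Qed.

Lemma b_tE (Y : D) n :
  pc_t (b_data B Y) n = turn cap n (cup Y) ∘ fmap (capS n) (lc_w cup Y).
Proof. by rewrite /turn -lock. Qed.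

Lemma b_simplicial (Y : D) : is_simplicial (b_data B Y).
Proof.
split.
- move=> n i [|j] // le_ij le_jn; have lt_in := leq_trans le_ij le_jn.
  rewrite !b_faceE //; last exact: ltnW.
  exact: (fmap_square cap (counit_counit _ _ le_ij le_jn)).
- move=> n i j le_ij le_jn; have le_in := leq_trans le_ij le_jn.
  rewrite !b_degenE //; last exact: leqW.
  exact: (fmap_square cap (comult_comult _ _ le_ij le_jn)).
- move=> n i [|j] // le_ij le_jn.
  have le_in : i <= n by exact: leq_trans le_ij le_jn.
  rewrite !b_degenE // !b_faceE; try by do ?apply: leqW.
  exact: (fmap_square cap (counit_comult_lt _ _ le_ij le_jn)).
- move=> n j le_jn; rewrite b_degenE // b_faceE; last exact: leqW.
  rewrite (fmap_triangle cap (counit_comult_id _ _ le_jn)).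
  exact: (fmap_id cap).
- move=> n j le_jn; rewrite b_degenE // b_faceE //.
  rewrite (fmap_triangle cap (counit_comult_idS _ _ le_jn)).
  exact: (fmap_id cap).
- move=> n [|i] j // lt_ji le_in; have lt_jn := leq_trans lt_ji le_in.
  rewrite !b_degenE // ?b_faceE //; last exact: ltnW.
  exact: (fmap_square cap (counit_comult_gt _ _ lt_ji le_in)).
Qed.

Lemma b_face0_t (Y : D) n :
  d_ (b_data B Y) n 0 ∘ pc_t (b_data B Y) n.+1 = d_ (b_data B Y) n n.+1.
Proof.
rewrite !b_faceE // b_tE comp_assoc counit0_turn pow_counit_last.
exact: (fmap_triangle (capS n.+1) (lc_e cup Y)).
Qed.

Lemma b_face_t (Y : D) n k : 1 <= k <= n.+1 ->
  d_ (b_data B Y) n k ∘ pc_t (b_data B Y) n.+1 =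
  pc_t (b_data B Y) n ∘ d_ (b_data B Y) n k.-1.
Proof.
case: k => // k le_kn; rewrite !b_faceE //; last exact: ltnW.
rewrite !b_tE comp_assoc counit_turn // -!comp_assoc; congr (_ ∘ _).
rewrite pow_counitS //.
exact: esym (fmap_square cap (pow_counit_natural Sl n k (lc_w cup Y))).
Qed.

Lemma b_degen_t (Y : D) n k : 1 <= k <= n ->
  s_ (b_data B Y) n k ∘ pc_t (b_data B Y) n =
  pc_t (b_data B Y) n.+1 ∘ s_ (b_data B Y) n k.-1.
Proof.
case: k n => // k [|n] // le_kn; rewrite !b_degenE //; last exact: ltnW.
rewrite !b_tE comp_assoc comult_turn // -!comp_assoc; congr (_ ∘ _).
rewrite pow_comultS //.
exact: esym (fmap_square cap (pow_comult_natural Sl n k (lc_w cup Y))).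
Qed.

(** By naturality the first turn can be postponed until both letters [Sr] have
    been created; the two letters so created are, by the comodule axiom of
    [w], the comultiplication of a single one, which is what [comult0_turn]
    needs. *)
Lemma b_degen0_t (Y : D) n :
  s_ (b_data B Y) n 0 ∘ pc_t (b_data B Y) n =
  pc_t (b_data B Y) n.+1 ∘ pc_t (b_data B Y) n.+1 ∘ s_ (b_data B Y) n n.
Proof.
rewrite !b_degenE // !b_tE comp_assoc comult0_turn pow_comult_last.
rewrite -!comp_assoc; congr (_ ∘ _).
rewrite (turnS cap n) -!comp_assoc [RHS]comp_assoc.
rewrite (turn_natural cap n (lc_w cup Y)) -!comp_assoc; congr (_ ∘ _).
have := congr1 (fun f => fmap (capS n) f) (lc_d cup Y).
by rewrite !fmap_comp -!comp_assoc.
Qed.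

Lemma b_para_cyclic (Y : D) : is_para_cyclic (b_data B Y).
Proof.
split.
- exact: b_simplicial.
- exact: b_face0_t.
- exact: b_face_t.
- exact: b_degen0_t.
- exact: b_degen_t.
Qed.

Lemma b_mor_pc_morphism (Y Y' : D) (f : hom Y Y') :
  is_pc_morphism (b_mor B f).
Proof.
split=> [n k|n k|n].
- exact: (fmap_square cap (pow_counit_natural Sl n.+1 k (fmap cup f))).
- exact: (fmap_square cap (pow_comult_natural Sl n k (fmap cup f))).
- rewrite !b_tE comp_assoc (turn_natural cap n (fmap cup f)) -!comp_assoc.
  congr (_ ∘ _).
  exact: (fmap_square (capS n) (nt_natural (lc_w cup) f)).
Qed.

Lemma b_functorP : @is_functor D (para_cyclic C)
  (fun Y => ParaCyclicObject (b_para_cyclic Y))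
  (fun Y Y' f => @PCMorphism C (ParaCyclicObject (b_para_cyclic Y))
                   (ParaCyclicObject (b_para_cyclic Y')) (b_mor B f)
                   (b_mor_pc_morphism f)).
Proof.
split=> [Y|Y Y' Y'' g f]; apply: pc_morphism_eq => n.
  by rewrite /= /b_mor !fmap_id.
by rewrite /= /b_mor !fmap_comp.
Qed.

End ParaCyclic.

Theorem corollary4p8 (M C D : category) (B : b_object M C D) :
  exists (F : functor D (para_cyclic C))
         (hob : forall Y : D, is_para_cyclic (b_data B Y))
         (hmor : forall (Y Y' : D) (f : hom Y Y'), is_pc_morphism (b_mor B f))
         (hF : @is_functor D (para_cyclic C)
                 (fun Y => ParaCyclicObject (hob Y))
                 (fun Y Y' f => @PCMorphism C (ParaCyclicObject (hob Y))
                                  (ParaCyclicObject (hob Y')) (b_mor B f) (hmor Y Y' f))),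
    F = Functor hF.
Proof.
exists (Functor (b_functorP B)), (b_para_cyclic B), (b_mor_pc_morphism B).
by exists (b_functorP B).
Qed.
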